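(* Let $\mathfrak{g} = T \oplus \sum_{\alpha\in R^+}\mathbb{C}\cdot X_\alpha$ be the Borel subalgebra of a complex semisimple Lie algebra, where $T$ is a Cartan subalgebra, $R$ is the root system, $R^+$ is a system of positive roots and each $X_\alpha$ is a nonzero root vector for $\alpha$. Let $\mathfrak{g}'=[\mathfrak{g},\mathfrak{g}]$. Then every ideal $J$ of $\mathfrak{g}$ is of the form $$J = S + (J\cap\mathfrak{g}'),$$ where $S$ is a subalgebra of $\bigcap_{\beta\in R^+\setminus R_J}\ker(\beta)\subseteq T$, with $R_J$ being the set of roots of $T$ in $J$.
   Context: $R$ is the root system of the complex semisimple Lie algebra with respect to the Cartan subalgebra $T$. Roots are regarded as linear functionals on $T$, and $\ker(\beta)=\{t\in T:\beta(t)=0\}$. The derived algebra is $\mathfrak{g}'=\sum_{\alpha\in R^+}\mathbb{C}\cdot X_\alpha$. $R_J$ is the set of $\alpha\in R^+$ whose root space is contained in $J$. If $R_J=R^+$, the (empty) intersection is understood to be $T$. *)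

(* Defs.v *)
From HB Require Import structures.
From mathcomp Require Import all_boot all_order all_algebra.
From mathcomp Require Import reals.
From mathcomp Require Export complex.
Set Implicit Arguments.
Unset Strict Implicit.
Unset Printing Implicit Defensive.
Import GRing.Theory.
Local Open Scope ring_scope.

(* Finite-dimensional Lie algebras over a field. *)
HB.mixin Record Vector_isLieAlg (F : fieldType) L of Vector F L := {
  lie : L -> L -> L;
  lie_linear_l : forall z : L, linear (fun x => lie x z);
  lie_linear_r : forall x : L, linear (lie x);
  liexx : forall x : L, lie x x = 0;
  jacobi : forall x y z : L,
    lie x (lie y z) + lie y (lie z x) + lie z (lie x y) = 0
}.

#[short(type="lieAlgType")]
HB.structure Definition LieAlg (F : fieldType) :=
  { L of Vector_isLieAlg F L & Vector F L }.

HB.instance Definition _ (F : fieldType) (L : lieAlgType F) (x : L) :=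
  GRing.isLinear.Build F L L *:%R (lie x) (lie_linear_r x).

Section LieTheory.
Variables (F : fieldType) (L : lieAlgType F).
Implicit Types (U V W T g J : {vspace L}).

Definition ad (x : L) : 'End(L) := linfun (lie x).

Lemma adE x y : ad x y = lie x y.
Proof. by rewrite lfunE. Qed.

(* The span [U, V] of all brackets of elements of U and V. *)
Definition liev U V : {vspace L} :=
  <<allpairs lie (vbasis U) (vbasis V)>>%VS.

Lemma memv_lie U V u v : u \in U -> v \in V -> lie u v \in liev U V.
Proof.
move=> Uu Vv.
rewrite (coord_vbasis Vv) linear_sum memv_suml // => j _.
rewrite linearZ /= memvZ //.
pose f : {linear L -> L} :=
  HB.pack (lie^~ (vbasis V)`_j)
    (GRing.isLinear.Build F L L *:%R (lie^~ (vbasis V)`_j)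
       (lie_linear_l (vbasis V)`_j)).
rewrite (coord_vbasis Uu) -[lie _ _]/(f _) linear_sum memv_suml // => i _.
rewrite linearZ memvZ // memv_span //.
by apply/allpairsP; exists ((vbasis U)`_i, (vbasis V)`_j); split=> //;
  rewrite mem_nth // size_tuple.
Qed.

Lemma lievP U V W :
  reflect {in U & V, forall u v, lie u v \in W} (liev U V <= W)%VS.
Proof.
apply: (iffP idP) => [/subvP sW u v Uu Vv|WUV]; first exact/sW/memv_lie.
apply/span_subvP=> _ /allpairsP[[u v] /= [Uu Vv ->]].
by apply: WUV; apply: vbasis_mem.
Qed.

Definition is_subalgebra U : bool := (liev U U <= U)%VS.

Definition is_ideal g J : bool := (J <= g)%VS && (liev g J <= J)%VS.

Definition derived_series U (n : nat) : {vspace L} :=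
  iter n (fun V => liev V V) U.

Definition is_solvable U : Prop := exists n, derived_series U n = 0%VS.

Definition is_semisimple : Prop :=
  forall J, is_ideal fullv J -> is_solvable J -> J = 0%VS.

Definition is_abelian U : bool := liev U U == 0%VS.

Definition ad_diagonalizable (x : L) : Prop :=
  exists2 e : seq L, basis_of fullv e &
    {in e, forall v, exists c : F, lie x v = c *: v}.

(* The usual definition for a complex semisimple Lie algebra: a maximal abelian
   subalgebra all of whose elements act diagonalizably on L.               *)
Definition is_cartan T : Prop :=
  [/\ is_abelian T,
      (forall U, is_abelian U -> (T <= U)%VS -> U = T)
    & {in T, forall t, ad_diagonalizable t}].

Definition dual T := 'Hom(subvs_of T, F^o).

(* The space of the x in V with [t, x] = a(t) x for all t in T; see weightvP. *)
Definition weightv T V (a : dual T) : {vspace L} :=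
  (V :&: \bigcap_(t <- vbasis {: subvs_of T})
           lker (ad (vsval t) - (a t : F) *: (\1%VF : 'End(L))))%VS.

Lemma weightvP T V (a : dual T) x :
  reflect (x \in V /\ forall t : subvs_of T, lie (vsval t) x = a t *: x)
          (x \in weightv V a).
Proof.
have memI (s : seq (subvs_of T)) :
    (x \in \bigcap_(t <- s) lker (ad (vsval t) - (a t : F) *: (\1%VF : 'End(L))))%VS
    = all (fun t => lie (vsval t) x == a t *: x) s.
  elim: s => [|t s IHs] /=; first by rewrite big_nil memvf.
  rewrite big_cons memv_cap IHs memv_ker.
  by rewrite add_lfunE opp_lfunE scale_lfunE id_lfunE adE subr_eq0.
rewrite /weightv memv_cap memI.
apply: (iffP andP) => -[Vx ax]; split=> //; last first.
  by apply/allP=> t _; rewrite ax.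
move=> t.
pose f : {linear L -> L} :=
  HB.pack (lie^~ x) (GRing.isLinear.Build F L L *:%R (lie^~ x) (lie_linear_l x)).
rewrite -[lie _ _]/(f _) (coord_vbasis (memvf t)) !linear_sum scaler_suml.
apply: eq_bigr => i _; rewrite !linearZ /= -scalerA.
by congr (_ *: _); apply/eqP/(allP ax)/mem_nth; rewrite size_tuple.
Qed.

Definition is_root T (a : dual T) : bool :=
  (a != 0) && (weightv fullv a != 0%VS).

(* P enumerates a closed set of roots containing exactly one of each pair
   of opposite roots.                                                      *)
Definition is_positive_system T (P : seq (dual T)) : Prop :=
  [/\ uniq P,
      {in P, forall a, is_root a},
      (forall a, is_root a -> (a \in P) (+) (- a \in P))
    & {in P & P, forall a b, is_root (a + b) -> a + b \in P}].

(* R_J, for J a subspace of g: the root spaces are those of g. When g is a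
   Borel subalgebra they coincide with those of L for positive roots.      *)
Definition roots_in T (P : seq (dual T)) g J : seq (dual T) :=
  [seq a <- P | weightv g a <= J]%VS.

(* The common kernel in T of the functionals in s, as a subspace of L; it is
   T itself when s is empty.                                               *)
Definition common_ker T (s : seq (dual T)) : {vspace L} :=
  (linfun vsval @: \bigcap_(b <- s) lker b)%VS.

Lemma common_kerP T (s : seq (dual T)) x :
  reflect (exists2 t : subvs_of T, x = vsval t & {in s, forall b : dual T, b t = 0})
          (x \in common_ker s).
Proof.
have memI (t : subvs_of T) :
    (t \in \bigcap_(b <- s) lker b)%VS = all (fun b : dual T => b t == 0) s.
  elim: s => [|b s IHs] /=; first by rewrite big_nil memvf.
  by rewrite big_cons memv_cap IHs memv_ker.
apply: (iffP memv_imgP) => -[t].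
  by rewrite memI lfunE => /allP s0 ->; exists t => // b /s0/eqP.
by move=> -> s0; exists t; rewrite ?lfunE // memI; apply/allP=> b /s0/eqP.
Qed.

End LieTheory.

(* Main.v *)
Require Import Defs.
From HB Require Import structures.
From mathcomp Require Import all_boot all_order all_algebra.
From mathcomp Require Import reals.
Set Implicit Arguments.
Unset Strict Implicit.
Unset Printing Implicit Defensive.
Import GRing.Theory.
Local Open Scope ring_scope.

(** An ideal [J] of [g] is stable under [ad T], so it contains the weight
components of each of its elements; as [g] is the sum of [T] (weight 0) and the
lines through the [X a], with distinct nonzero weights, [J] is the sum of
[J :&: T] and of the [X a] lying in [J]. The latter are in [g'] because
[[t, X a] = a(t) X a] with [a != 0]. By the same formula, if [t] is in [J :&: T]
and [b(t) != 0] then [X b] is in [J]. *)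

(** Distinct entries allow the summands to be indexed by [I] itself: the value chosen at the head
    [i] cannot clash with a later choice. *)
Lemma memv_sum_seqP (K : fieldType) (V : vectType K) (I : eqType) (s : seq I)
    (U : I -> {vspace V}) (x : V) :
  uniq s -> x \in (\sum_(i <- s) U i)%VS ->
  exists2 v : I -> V, {in s, forall i, v i \in U i} & x = \sum_(i <- s) v i.
Proof.
elim: s x => [|i s IHs] x /=.
  by rewrite big_nil memv0 => _ /eqP->; exists (fun=> 0); rewrite ?big_nil.
case/andP=> s'i uniq_s; rewrite big_cons => /memv_addP[u Uu [y /(IHs _ uniq_s)]].
case=> v Uv -> ->; exists (fun j => if j == i then u else v j).
  by move=> j; rewrite inE; case: eqVneq => [->|_] //= /Uv.
rewrite big_cons eqxx; congr (_ + _); apply: eq_big_seq => j s_j.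
by case: eqVneq s_j s'i => // -> ->.
Qed.

Lemma lieC (F : fieldType) (L : lieAlgType F) (x y : L) : lie x y = - lie y x.
Proof.
have lieDl u v z : lie (u + v) z = lie u z + lie v z :> L.
  by have := lie_linear_l z 1 u v; rewrite !scale1r.
apply/eqP; rewrite -addr_eq0; have := liexx (x + y).
by rewrite lieDl !linearD /= !liexx add0r addr0 => ->.
Qed.

Section Weights.
Variables (F : fieldType) (L : lieAlgType F) (T : {vspace L}).

Definition weight_vector (a : dual T) (x : L) : Prop :=
  forall t : subvs_of T, lie (vsval t) x = (a t : F) *: x.

Lemma weight_vectorZ a c x : weight_vector a x -> weight_vector a (c *: x).
Proof. by move=> ax t; rewrite linearZ /= ax !scalerA mulrC. Qed.

Lemma weight_vectorB a x y :
  weight_vector a x -> weight_vector a y -> weight_vector a (x - y).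
Proof. by move=> ax ay t; rewrite linearB /= ax ay scalerBr. Qed.

Lemma weight_vector0 a : weight_vector a 0.
Proof. by move=> t; rewrite linear0 scaler0. Qed.

Lemma abelian_weight0 x : is_abelian T -> x \in T -> weight_vector 0 x.
Proof.
move=> /eqP abT Tx t; rewrite lfunE scale0r; apply/eqP.
by rewrite -memv0 -abT memv_lie // subvsP.
Qed.

Lemma dual_neqP (a b : dual T) : a != b -> exists t, (a t : F) != b t.
Proof.
move=> neq_ab; have: (lker (a - b) != fullv)%VS.
  apply: contraNneq neq_ab => kab; apply/eqP/lfunP=> t; apply/eqP.
  by rewrite -subr_eq0 -opp_lfunE -add_lfunE -memv_ker kab memvf.
rewrite eqEsubv subvf /= => /subvPn[t _].
by rewrite memv_ker add_lfunE opp_lfunE subr_eq0; exists t.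
Qed.

(** Induction on the number of weights, as for eigenvectors of distinct eigenvalues. [W = J] splits
    elements of the ideal; [W = 0] is the linear independence of weight vectors with distinct
    weights. *)
Lemma weight_components_mem (W : {vspace L}) (s : seq (dual T))
    (v : dual T -> L) :
    (forall (t : subvs_of T) w, w \in W -> lie (vsval t) w \in W) ->
    uniq s -> {in s, forall a, weight_vector a (v a)} ->
  \sum_(a <- s) v a \in W -> {in s, forall a, v a \in W}.
Proof.
move=> stW; elim: s v => // a s IHs v /= /andP[s'a uniq_s] wt_v Wv.
have{IHs} Ws b : b \in s -> v b \in W.
  move=> s_b; have [|t neq_ab] := @dual_neqP b a; first by apply: contraNneq s'a => <-.
  (* [ad t - a t] kills the component of weight [a] and scales the others. *)
  pose v' (c : dual T) := ((c t : F) - a t) *: v c.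
  have Wv' : \sum_(c <- s) v' c \in W.
    have := memvB (stW t _ Wv) (memvZ (a t : F) Wv).
    rewrite linear_sum scaler_sumr -sumrB big_cons /=.
    rewrite wt_v ?mem_head // subrr add0r; congr (_ \in W).
    apply: eq_big_seq => c s_c.
    by rewrite wt_v ?inE ?s_c ?orbT // -scalerBl.
  have wt_v' : {in s, forall c, weight_vector c (v' c)}.
    by move=> c s_c; apply/weight_vectorZ/wt_v; rewrite inE s_c orbT.
  have := IHs v' uniq_s wt_v' Wv' b s_b.
  by rewrite rpredZeq subr_eq0 (negPf neq_ab).
move=> b; rewrite inE => /predU1P[->|/Ws//].
have Wsum : \sum_(c <- s) v c \in W.
  by rewrite big_seq; apply: memv_suml => c /Ws.
by move: (memvB Wv Wsum); rewrite big_cons addrK.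
Qed.

End Weights.

Theorem corollary2p2 (R : realType) (L : lieAlgType R[i])
    (T : {vspace L}) (Rp : seq (dual T)) (X : dual T -> L)
    (g g' J : {vspace L})
    (hL : is_semisimple L)
    (hT : is_cartan T)
    (hRp : is_positive_system Rp)
    (hX : {in Rp, forall a, X a != 0 /\ X a \in weightv fullv a})
    (hg : g = (T + \sum_(a <- Rp) <[X a]>)%VS)
    (hg' : g' = liev g g)
    (hJ : is_ideal g J) :
  exists S : {vspace L},
    [/\ is_subalgebra S,
        (S <= common_ker [seq b <- Rp | b \notin roots_in Rp g J])%VS
      & J = (S + (J :&: g'))%VS].
Proof.
have [abT _ _] := hT; have [uniqRp rootRp _ _] := hRp.
have /andP[sJg /lievP idJ] := hJ.
have Rp'0 : 0 \notin Rp by apply/negP=> /rootRp; rewrite /is_root eqxx.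
have uniqW : uniq (0 :: Rp) by rewrite /= Rp'0.
have wtX (a : dual T) : a \in Rp -> weight_vector a (X a).
  by move=> /hX[_ /weightvP[]].
have sTg : (T <= g)%VS by rewrite hg addvSl.
have gX (a : dual T) : a \in Rp -> X a \in g.
  move=> Rp_a; rewrite hg (subvP (addvSr _ _)) // (big_rem a) //=.
  by rewrite (subvP (addvSl _ _)) ?memv_line.
have decomp x : x \in g -> exists v : dual T -> L,
    [/\ v 0 \in T, {in Rp, forall a, v a \in <[X a]>%VS},
        {in 0 :: Rp, forall a, weight_vector a (v a)}
      & x = \sum_(a <- 0 :: Rp) v a].
  (* Since 0 is not a root, it can serve as the index of [T], which has weight 0 because it is
     abelian. *)
  pose U (a : dual T) := if a == 0 then T else <[X a]>%VS.
  have -> : g = (\sum_(a <- 0%R :: Rp) U a)%VS.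
    rewrite hg big_cons /U eqxx; congr (_ + _)%VS; apply: eq_big_seq => a.
    by case: eqVneq => // ->; rewrite (negPf Rp'0).
  case/(memv_sum_seqP uniqW)=> v Uv def_x.
  have Tv0 : v 0 \in T by have := Uv 0 (mem_head _ _); rewrite /U eqxx.
  have Xv a : a \in Rp -> v a \in <[X a]>%VS.
    move=> Rp_a; have := Uv a; rewrite inE Rp_a orbT => /(_ isT).
    by rewrite /U; case: eqVneq Rp_a => // ->; rewrite (negPf Rp'0).
  exists v; split=> // a; rewrite inE => /predU1P[->|Rp_a].
    exact: abelian_weight0.
  by have /vlineP[c ->] := Xv a Rp_a; apply/weight_vectorZ/wtX.
(* [roots_in] tests the whole weight space of [g]; this bound reduces the test to [X b \in J]. *)
have weight_line b : b \in Rp -> (weightv g b <= <[X b]>)%VS.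
  move=> Rp_b; apply/subvP=> x /weightvP[gx wtx].
  have [v [_ Xv wtv def_x]] := decomp x gx.
  (* Subtracting [x] from the component of weight [b] makes the total 0, so by independence
     [x = v b], a multiple of [X b]. *)
  pose v' (a : dual T) := v a - (if a == b then x else 0).
  have Wb : b \in 0 :: Rp by rewrite inE Rp_b orbT.
  suff: v' b \in (0%VS : {vspace L}).
    by rewrite memv0 /v' eqxx subr_eq0 => /eqP <-; apply: Xv.
  apply: (weight_components_mem _ uniqW _ _ Wb) => [t w|a Wa|].
  - by rewrite memv0 => /eqP->; rewrite linear0 mem0v.
  - apply: weight_vectorB; first exact: wtv.
    by case: eqP => [->|_] //; apply: weight_vector0.
  rewrite sumrB -def_x -big_mkcond /= -big_filter filter_pred1_uniq //.
  by rewrite big_seq1 subrr mem0v.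
exists (J :&: T)%VS; split.
- apply/lievP=> u v /memv_capP[_ Tu] /memv_capP[_ Tv].
  suff -> : lie u v = 0 by apply: mem0v.
  by apply/eqP; rewrite -memv0 -(eqP abT) memv_lie.
- apply/subvP=> x /memv_capP[Jx Tx]; apply/common_kerP.
  exists (vsproj T x); first by rewrite vsprojK.
  move=> b; rewrite mem_filter => /andP[notJb Rp_b]; apply/eqP.
  apply: contraR notJb => bx_neq0; rewrite mem_filter Rp_b andbT.
  apply: subv_trans (weight_line b Rp_b) _; rewrite -memvE.
  (* [idJ] takes the factor from [J] on the right, hence the sign. The element is [[x, X b] = b(x) X
     b] with [b(x) != 0], which puts [X b] in [J]. *)
  have: - lie (X b) x \in J by rewrite memvN idJ ?gX.
  rewrite -lieC.
  by rewrite -{1}(vsprojK Tx) wtX // rpredZeq (negPf bx_neq0).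
apply/eqP; rewrite eqEsubv subv_add capvSl capvSl !andbT.
apply/subvP=> x Jx; have [v [Tv0 Xv wtv def_x]] := decomp x (subvP sJg x Jx).
have Jv : {in 0 :: Rp, forall a, v a \in J}.
  apply: weight_components_mem uniqW wtv _; last by rewrite -def_x.
  by move=> t w; apply/idJ/(subvP sTg)/subvsP.
(* The component of weight 0 goes to [J :&: T], the root components to [J :&: g']. *)
rewrite def_x big_cons memv_add //; first by rewrite memv_cap Tv0 Jv ?mem_head.
rewrite big_seq; apply: memv_suml => a Rp_a.
rewrite memv_cap Jv ?inE ?Rp_a ?orbT //=.
have /vlineP[c ->] := Xv a Rp_a; rewrite memvZ //.
(* A [t] with [a(t) != 0] makes [X a] a multiple of the bracket [[t, X a]]. *)
have [|t] := @dual_neqP _ _ T a 0; first by apply: contraNneq Rp'0 => <-.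
rewrite lfunE /= => at_neq0.
have: lie (vsval t) (X a) \in g'.
  by rewrite hg' memv_lie ?gX // (subvP sTg) ?subvsP.
by rewrite wtX // rpredZeq (negPf at_neq0).
Qed.
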